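(* Let $f_1,\dots,f_N:\mathcal{X}\to\mathbb{R}$ be such that each $f_i$ is strictly convex, continuously differentiable, and has a minimizer $x_i^*\in\mathcal{X}$. For $k\in\mathbb{P}$ and $u(k)=\{u_1(k),u_2(k)\}$, labelled so that $\hat{x}_{u_1(k)}(k-1)\le\hat{x}_{u_2(k)}(k-1)$, consider the following conditions relating $\mathbf{x}(k)\in\mathcal{X}^N$ to $\mathbf{x}(k-1)\in\mathcal{X}^N$: (i) $\hat{x}_i(k)=\hat{x}_i(k-1)$ for all $i\in\mathcal{V}\setminus u(k)$; (ii) $f_{u_1(k)}'(\hat{x}_{u_1(k)}(k))+f_{u_2(k)}'(\hat{x}_{u_2(k)}(k))=f_{u_1(k)}'(\hat{x}_{u_1(k)}(k-1))+f_{u_2(k)}'(\hat{x}_{u_2(k)}(k-1))$; (iii) $\hat{x}_{u_1(k)}(k-1)\le\hat{x}_{u_1(k)}(k)\le\hat{x}_{u_2(k)}(k)\le\hat{x}_{u_2(k)}(k-1)$. Then, for any given sequence of gossiping pairs $(u(k))_{k=1}^\infty$ and any sequence $(\mathbf{x}(k))_{k=0}^\infty$ in $\mathcal{X}^N$ with $\hat{x}_i(0)=x_i^*$ for all $i\in\mathcal{V}$ that satisfies (i)–(iii) for all $k\in\mathbb{P}$, the sequence $(V(\mathbf{x}(k)))_{k=0}^\infty$ is non-increasing. Moreover, for any given $k\in\mathbb{P}$ and $\mathbf{x}(k-1)\in\mathcal{X}^N$, the value $V(\mathbf{x}(k))$, for $\mathbf{x}(k)$ satisfying (i)–(iii), strictly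 increases with $\hat{x}_{u_2(k)}(k)-\hat{x}_{u_1(k)}(k)$ over $[0,\hat{x}_{u_2(k)}(k-1)-\hat{x}_{u_1(k)}(k-1)]$; that is, of two vectors $\mathbf{x}(k)$ satisfying (i)–(iii) for the same $\mathbf{x}(k-1)$ and $u(k)$, the one with strictly larger difference $\hat{x}_{u_2(k)}(k)-\hat{x}_{u_1(k)}(k)$ has strictly larger value of $V$.
   Context: Let $N\ge 2$, $\mathcal{V}=\{1,2,\dots,N\}$, $\mathbb{P}=\{1,2,\dots\}$, and let $\mathcal{X}\subset\mathbb{R}$ be a nonempty open interval. For each time $k$ the network is an undirected graph $(\mathcal{V},\mathcal{E}(k))$, where $\mathcal{E}(k)\subset\{\{i,j\}:i,j\in\mathcal{V},i\ne j\}$ is nonempty. A sequence of gossiping pairs is a sequence $(u(k))_{k=1}^\infty$ with $u(k)=\{u_1(k),u_2(k)\}\in\mathcal{E}(k)$ a pair of distinct nodes for every $k\in\mathbb{P}$ (the topology is arbitrary and time-varying, so $u(k)$ may be any pair of distinct nodes). Write $\mathbf{x}(k)=(\hat{x}_1(k),\dots,\hat{x}_N(k))$. Let $F(x)=\sum_{i\in\mathcal{V}}f_i(x)$ for $x\in\mathcal{X}$, and let $x^*$ denote the unique minimizer of $F$ over $\mathcal{X}$ (it exists under the stated assumptions on the $f_i$). Derivatives are denoted $f_i'$. The function $V:\mathcal{X}^N\to\mathbb{R}$ is $$V(x_1,\dots,x_N)=\sum_{i\in\mathcal{V}}\Bigl(f_i(x^* )-f_i(x_i)-f_i'(x_i)(x^*-x_i)\Bigr).$$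 *)

(* Defs.v *)
(* MathComp-Analysis, over an abstract [R : realType]. *)
From HB Require Import structures.
From mathcomp Require Export all_boot all_order all_algebra.
From mathcomp Require Export all_classical all_reals all_analysis.
Export Order.TTheory GRing.Theory Num.Theory.
Export numFieldNormedType.Exports.

Set Implicit Arguments.
Unset Strict Implicit.
Unset Printing Implicit Defensive.

Local Open Scope classical_set_scope.
Local Open Scope ring_scope.

(* A function on X is represented by a total function on R.  The definitions
   below only look at its values on X; since X is an open set in the theorem,
   the derivative at a point of X also depends on these values only. *)

Definition strictly_convex_on (R : realType) (X : set R) (g : R -> R) : Prop :=
  forall x y t : R, X x -> X y -> x != y -> 0 < t -> t < 1 ->
    g (t * x + (1 - t) * y) < t * g x + (1 - t) * g y.

Definition continuously_differentiable_on (R : realType) (X : set R)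
    (g : R -> R) : Prop :=
  (forall x, X x -> derivable g x 1) /\ {within X, continuous derive1 g}.

Definition is_minimizer (R : realType) (X : set R) (g : R -> R) (m : R) : Prop :=
  X m /\ forall x, X x -> g m <= g x.

Definition in_power (R : realType) (N : nat) (X : set R) (x : 'I_N -> R) : Prop :=
  forall i, X (x i).

(* Edges are unordered pairs of distinct nodes, encoded as two-element sets. *)
Definition edge_set (N : nat) (E : {set {set 'I_N}}) : Prop :=
  forall e, e \in E -> #|e| = 2%N.

(* (a, b) lists the gossiping pair e with the lower current estimate first.
   When the two estimates coincide, both orderings are allowed. *)
Definition labelled (R : realType) (N : nat) (e : {set 'I_N}) (x : 'I_N -> R)
    (a b : 'I_N) : Prop :=
  e = [set a; b]%SET /\ x a <= x b.

Definition sum_objective (R : realType) (N : nat) (f : 'I_N -> R -> R)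
    (x : R) : R :=
  \sum_(i < N) f i x.

Definition lyapunov (R : realType) (N : nat) (f : 'I_N -> R -> R) (xs : R)
    (x : 'I_N -> R) : R :=
  \sum_(i < N) (f i xs - f i (x i) - derive1 (f i) (x i) * (xs - x i)).

(* Conditions relating the estimates x before and y after a gossip between
   a and b, where x a <= x b. *)
Definition gossip_update (R : realType) (N : nat) (f : 'I_N -> R -> R)
    (a b : 'I_N) (x y : 'I_N -> R) : Prop :=
  [/\ forall i, i \notin [set a; b]%SET -> y i = x i,
      derive1 (f a) (y a) + derive1 (f b) (y b) =
      derive1 (f a) (x a) + derive1 (f b) (x b)
    & [/\ x a <= y a, y a <= y b & y b <= x b]].

(* Main.v *)
Require Import Defs.
From mathcomp Require Import ring lra.

(** The function V is the sum over the nodes i of the Bregman divergences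
    B_i(x*, x_i) of f_i, where B_i(p, w) is the gap at p between f_i and its
    tangent at w.  Strict convexity makes B_i(p, w) positive unless p = w.

    Take two states y and z that differ only at a and b and have the same sum
    f_a' + f_b'.  The three-point identity of Bregman divergences, applied at
    a and at b, eliminates x*: the two first-order terms carry opposite
    coefficients, so that x* cancels and
      V(z) - V(y) = B_a(y_a, z_a) + B_b(y_b, z_b)
                    + (f_a'(y_a) - f_a'(z_a)) (y_b - y_a).
    If z_a <= y_a <= y_b, all three terms are nonnegative, f_a' being
    increasing, and the first two vanish only when z and y agree
    ([lyapunov_nested_le]).

    Both claims are instances of this comparison.  For monotonicity in time,
    z is the state before the gossip and y the state after it.  For two
    outcomes y and z of the same gossip with y_b - y_a < z_b - z_a,
    the condition z_a <= y_a holds because f_a' and f_b' are strictly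
    increasing with the same sum at y and z: moving a up forces b down, which
    shrinks the gap. *)

Set Implicit Arguments.
Unset Strict Implicit.
Unset Printing Implicit Defensive.

Local Open Scope classical_set_scope.
Local Open Scope ring_scope.

(** A convexity inequality bounds the values of g along a segment, and the
    parameter t of the segment runs over positive numbers only.  Scaling the
    direction by v lets one right-hand limit serve for points on either side
    of w. *)
Lemma directional_quotient_cvg (R : realType) (g : R -> R) (w v : R) :
  derivable g w 1 ->
  t^-1 * (g (t * v + w) - g w) @[t --> 0^'+] --> derive1 g w * v.
Proof.
move=> /derivable1_diffP dg; apply: cvg_dnbhs_at_right.
have -> : derive1 g w * v = 'D_v g w.
  rewrite (derive1E' dg) (deriveE v dg).
  by rewrite -[in RHS](mulr1 v) -[v * 1]/(v *: 1) linearZ mulrC.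
exact: (diff_derivable (v := v) dg).
Qed.

(** Letting t tend to 0 in the chord inequality yields only the weak tangent
    inequality.  Strictness comes back from applying it at the midpoint of w
    and p, where g lies strictly below the chord. *)
Lemma tangent_lt (R : realType) (X : set R) (g : R -> R) (w p : R) :
  is_interval X -> strictly_convex_on X g -> derivable g w 1 ->
  X w -> X p -> w != p -> g w + derive1 g w * (p - w) < g p.
Proof.
move=> Xi gX dg Xw Xp wp.
have tangent_le q : X q -> q != w -> derive1 g w * (q - w) <= g q - g w.
  move=> Xq qw.
  have quot := directional_quotient_cvg (v := q - w) dg.
  apply: (cvgr_to_le quot).
  near=> t.
  have t0 : 0 < t by near: t; exact: nbhs_right_gt.
  have t1 : t < 1 by near: t; exact: nbhs_right_lt.
  rewrite ler_pdivrMl//.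
  have := gX q w t Xq Xw qw t0 t1.
  have -> : t * q + (1 - t) * w = t * (q - w) + w by ring.
  lra.
have Xm : X (2^-1 * w + (1 - 2^-1) * p).
  have [lt_wp|lt_pw|eq_wp] := ltgtP w p.
  - by apply: (Xi w p) => //; apply/andP; split; lra.
  - by apply: (Xi p w) => //; apply/andP; split; lra.
  - by rewrite eq_wp eqxx in wp.
have mw : 2^-1 * w + (1 - 2^-1) * p != w.
  apply: contra_neq wp; lra.
have chord : g (2^-1 * w + (1 - 2^-1) * p) < 2^-1 * g w + (1 - 2^-1) * g p.
  by apply: gX => //; lra.
have := tangent_le _ Xm mw.
have -> : 2^-1 * w + (1 - 2^-1) * p - w = 2^-1 * (p - w) by field.
rewrite mulrCA; lra.
Unshelve. all: by end_near. Qed.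

(** Adding the tangent inequality at w, evaluated at p, to the one at p,
    evaluated at w, cancels the values of g and leaves
    (g'(p) - g'(w)) (p - w) > 0. *)
Lemma derive1_lt (R : realType) (X : set R) (g : R -> R) (w p : R) :
  is_interval X -> strictly_convex_on X g ->
  derivable g w 1 -> derivable g p 1 ->
  X w -> X p -> w < p -> derive1 g w < derive1 g p.
Proof.
move=> Xi gX dw dp Xw Xp wp.
have tw := tangent_lt Xi gX dw Xw Xp (negbT (lt_eqF wp)).
have tp := tangent_lt Xi gX dp Xp Xw (negbT (gt_eqF wp)).
rewrite -subr_gt0 -(pmulr_lgt0 _ (_ : 0 < p - w)) ?subr_gt0//; lra.
Qed.

Definition bregman (R : realType) (g : R -> R) (p w : R) : R :=
  g p - g w - derive1 g w * (p - w).

Lemma bregman_gt0 (R : realType) (X : set R) (g : R -> R) (p w : R) :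
  is_interval X -> strictly_convex_on X g -> derivable g w 1 ->
  X p -> X w -> w != p -> 0 < bregman g p w.
Proof.
move=> Xi gX dg Xp Xw wp; rewrite /bregman.
have := tangent_lt Xi gX dg Xw Xp wp; lra.
Qed.

Lemma bregman_ge0 (R : realType) (X : set R) (g : R -> R) (p w : R) :
  is_interval X -> strictly_convex_on X g -> derivable g w 1 ->
  X p -> X w -> 0 <= bregman g p w.
Proof.
move=> Xi gX dg Xp Xw; have [<-|wp] := eqVneq w p.
  by rewrite /bregman !subrr mulr0 subr0.
exact/ltW/(bregman_gt0 Xi).
Qed.

(** The reference point p survives only in a term linear in p, which is what
    allows it to cancel between two nodes. *)
Lemma bregman_three_point (R : realType) (g : R -> R) (p y z : R) :
  bregman g p z - bregman g p y =
  bregman g y z + (derive1 g y - derive1 g z) * (p - y).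
Proof. rewrite /bregman; ring. Qed.

(** The first-order coefficients at a and b in the three-point identity are
    opposite since the sums of derivatives agree, so xs drops out. *)
Lemma lyapunov_diff_pair (R : realType) (N : nat) (f : 'I_N -> R -> R) (xs : R)
    (a b : 'I_N) (y z : 'I_N -> R) :
  a != b -> (forall i, i \notin [set a; b]%SET -> y i = z i) ->
  derive1 (f a) (y a) + derive1 (f b) (y b) =
  derive1 (f a) (z a) + derive1 (f b) (z b) ->
  lyapunov f xs z - lyapunov f xs y =
  bregman (f a) (y a) (z a) + bregman (f b) (y b) (z b) +
  (derive1 (f a) (y a) - derive1 (f a) (z a)) * (y b - y a).
Proof.
move=> ab yz sum_eq.
rewrite -sumrB (bigD1 a)//= (bigD1 b) 1?eq_sym//= big1 ?addr0; last first.
  by move=> i /andP[ia ib]; rewrite yz ?subrr// !inE negb_or ia.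
rewrite -!/(bregman _ _ _) !bregman_three_point.
have -> : derive1 (f b) (y b) - derive1 (f b) (z b) =
          - (derive1 (f a) (y a) - derive1 (f a) (z a)) by lra.
ring.
Qed.

(** Each of the three terms of [lyapunov_diff_pair] is nonnegative.  The
    equality case is what gives the strict comparison of two outcomes of the
    same gossip. *)
Lemma lyapunov_nested_le (R : realType) (N : nat) (X : set R)
    (f : 'I_N -> R -> R) (xs : R) (a b : 'I_N) (y z : 'I_N -> R) :
  is_interval X -> (forall i, strictly_convex_on X (f i)) ->
  (forall i x, X x -> derivable (f i) x 1) ->
  in_power X y -> in_power X z ->
  a != b -> (forall i, i \notin [set a; b]%SET -> y i = z i) ->
  derive1 (f a) (y a) + derive1 (f b) (y b) =
  derive1 (f a) (z a) + derive1 (f b) (z b) ->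
  z a <= y a -> y a <= y b ->
  lyapunov f xs y <= lyapunov f xs z ?= iff (z a == y a) && (z b == y b).
Proof.
move=> Xi fX df Xy Xz ab yz sum_eq za yab.
have diff := lyapunov_diff_pair xs ab yz sum_eq.
have Da := bregman_ge0 Xi (fX a) (df a _ (Xz a)) (Xy a) (Xz a).
have Db := bregman_ge0 Xi (fX b) (df b _ (Xz b)) (Xy b) (Xz b).
have slope : 0 <= (derive1 (f a) (y a) - derive1 (f a) (z a)) * (y b - y a).
  apply: mulr_ge0; rewrite subr_ge0//.
  move: za; rewrite le_eqVlt => /predU1P[->//|za].
  by apply/ltW/(derive1_lt Xi (fX a)) => //; exact: df.
split; first by lra.
have [/andP[/eqP za_eq /eqP zb_eq]|] := boolP (_ && _).
  apply/eqP; apply: eq_bigr => i _.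
  suff -> : y i = z i by [].
  have [|/yz//] := boolP (i \in [set a; b]%SET).
  by rewrite !inE => /orP[] /eqP ->.
rewrite negb_and => /orP[za_ne|zb_ne]; apply/lt_eqF.
- have := bregman_gt0 Xi (fX a) (df a _ (Xz a)) (Xy a) (Xz a) za_ne; lra.
- have := bregman_gt0 Xi (fX b) (df b _ (Xz b)) (Xy b) (Xz b) zb_ne; lra.
Qed.

Theorem lemma3 (R : realType) (N : nat) (hN : (2 <= N)%N)
  (X : set R) (X_nonempty : X !=set0) (X_open : open X)
  (X_interval : is_interval X)
  (f : 'I_N -> R -> R)
  (f_convex : forall i, strictly_convex_on X (f i))
  (f_C1 : forall i, continuously_differentiable_on X (f i))
  (xmin : 'I_N -> R) (f_min : forall i, is_minimizer X (f i) (xmin i))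
  (xs : R) (xs_min : is_minimizer X (sum_objective f) xs)
  (E : nat -> {set {set 'I_N}})
  (E_edges : forall k, (0 < k)%N -> edge_set (E k))
  (E_nonempty : forall k, (0 < k)%N -> exists e, e \in E k)
  (u : nat -> {set 'I_N})
  (u_edge : forall k, (0 < k)%N -> u k \in E k) :
  (forall x : nat -> 'I_N -> R,
     (forall k, in_power X (x k)) ->
     (forall i, x 0%N i = xmin i) ->
     (forall k, (0 < k)%N -> exists a b : 'I_N,
        labelled (u k) (x k.-1) a b /\ gossip_update f a b (x k.-1) (x k)) ->
     nonincreasing_seq (fun k => lyapunov f xs (x k)))
  /\
  (forall (k : nat) (x : 'I_N -> R) (a b : 'I_N),
     (0 < k)%N -> in_power X x -> labelled (u k) x a b ->
     forall y z : 'I_N -> R,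
       in_power X y -> gossip_update f a b x y ->
       in_power X z -> gossip_update f a b x z ->
       y b - y a < z b - z a ->
       lyapunov f xs y < lyapunov f xs z).
Proof.
have df i x : X x -> derivable (f i) x 1 by case: (f_C1 i) => + _; apply.
have label_neq k (x : 'I_N -> R) a b :
    (0 < k)%N -> labelled (u k) x a b -> a != b.
  move=> k0 [uE _]; have := E_edges k k0 _ (u_edge k k0).
  by rewrite uE cards2; case: (a != b).
split.
- move=> x Xx _ step; apply/nonincreasing_seqP => k.
  have [a [b [lab [frame sum_eq [xa yab _]]]]] := step k.+1 isT.
  have ab := label_neq k.+1 _ _ _ isT lab.
  exact: (lyapunov_nested_le xs X_interval f_convex df (Xx k.+1) (Xx k) ab
    frame sum_eq xa yab).
- move=> k x a b k0 _ lab y z Xy [frame_y sum_y [_ yab _]].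
  move=> Xz [frame_z sum_z [_ zab _]] narrower.
  have ab := label_neq _ _ _ _ k0 lab.
  have sum_eq := etrans sum_y (esym sum_z).
  (* Otherwise the narrower gap of y forces y b < z b as well, and both
     derivatives increase from y to z while their sum is the same. *)
  have za : z a <= y a.
    rewrite leNgt; apply/negP => ya_lt.
    have slope_a := derive1_lt X_interval (f_convex a)
      (df a _ (Xy a)) (df a _ (Xz a)) (Xy a) (Xz a) ya_lt.
    have yzb : y b < z b by lra.
    have slope_b := derive1_lt X_interval (f_convex b)
      (df b _ (Xy b)) (df b _ (Xz b)) (Xy b) (Xz b) yzb.
    lra.
  have yz i : i \notin [set a; b]%SET -> y i = z i.
    by move=> iab; rewrite frame_y// frame_z.
  rewrite (lt_leif (lyapunov_nested_le xs X_interval f_convex df Xy Xz ab yz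
    sum_eq za yab)).
  by apply/negP => /andP[/eqP za_eq /eqP zb_eq]; move: narrower; lra.
Qed.
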